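(* Suppose that $L$ is irreducible, that $\rho>\lambda_0(1-\gamma)$, and that $g>\lambda_1$ (the last two assertions are equivalent to $\lambda_0>g>\lambda_1$). Define $$y=\alpha b^0+\sum_{m=1}^{n-1}\frac{\beta_m}{\lambda_m-g}\,b^m,\qquad \beta_m=\langle\widehat c(b^0),b^m\rangle,\quad m=1,\dots,n-1,$$ where $\widehat c(b^0)$ is the vector with components $\widehat c_i(b^0)=(p_i/b^0_i)^{1/\gamma}$. Then $\{y,b^1,\dots,b^{n-1}\}$ is a basis of $\mathbb{R}^n$ consisting of eigenvectors of $B=L+A-F$, with corresponding eigenvalues $g,\lambda_1,\dots,\lambda_{n-1}$. In particular, $g$ is the dominant eigenvalue of $B$ and it is simple.
   Context: Here $n\ge2$, $\rho>0$, $\gamma>0$ with $\gamma\ne1$, $p_1,\dots,p_n>0$, $A=\mathrm{diag}(A_1,\dots,A_n)$ with $A_i>0$. $W=(w_{ij})$ is a symmetric matrix of graph weights with $w_{ij}\ge0$, $w_{ii}=0$, and $L=(\ell_{ij})$ is given by $\ell_{ij}=w_{ij}$ for $i\neq j$ and $\ell_{ii}=-\sum_{j\ne i}w_{ij}$. $L$ irreducible means that the graph on $\{1,\dots,n\}$ with edges $\{i,j\}$ whenever $w_{ij}>0$ is connected. $\lambda_0\ge\lambda_1\ge\dots\ge\lambda_{n-1}$ are the eigenvalues of the symmetric matrix $L+A$ with an orthonormal basis of eigenvectors $b^0,\dots,b^{n-1}$, where $b^0$ has strictly positive components. Put $\Phi(b^0)=\sum_{i=1}^np_i^{1/\gamma}(b^0_i)^{(\gamma-1)/\gamma}$,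 $\alpha=\frac{\gamma\Phi(b^0)}{\rho-\lambda_0(1-\gamma)}$, $g=\frac{\lambda_0-\rho}{\gamma}$, and let $F$ be the $n\times n$ matrix with entries $f_{ij}=\frac1\alpha\left(\frac{p_i}{b^0_i}\right)^{1/\gamma}b^0_j$. The dominant eigenvalue is the one with largest real part. *)

(* Defs.v *)
From mathcomp Require Import all_boot all_order all_algebra.
From mathcomp Require Import complex.
From mathcomp Require Import all_classical all_reals all_analysis.

Set Implicit Arguments.
Unset Strict Implicit.
Unset Printing Implicit Defensive.

Import Order.TTheory GRing.Theory Num.Theory.

Local Open Scope ring_scope.

(* Vectors of R^n are column vectors, and eigenvectors are right
   eigenvectors.  The library's [eigenvalue] is phrased with row vectors; it
   is used below only for the spectrum, which is the same on both sides. *)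

Definition dotv (R : realType) (n : nat) (u v : 'cV[R]_n) : R :=
  \sum_(i < n) u i 0 * v i 0.

Definition orthonormal_family (R : realType) (n : nat)
    (b : 'I_n -> 'cV[R]_n) : Prop :=
  forall i j : 'I_n, dotv (b i) (b j) = (i == j)%:R.

Definition is_eigenvector (R : realType) (n : nat) (M : 'M[R]_n) (a : R)
    (v : 'cV[R]_n) : Prop :=
  v != 0 /\ M *m v = a *: v.

(* Simple means of algebraic multiplicity one. *)
Definition simple_eigenvalue (R : realType) (n : nat) (M : 'M[R]_n) (a : R)
    : Prop :=
  mup a (char_poly M) = 1%N.

(* All complex eigenvalues of the real matrix M compete, and the maximum of
   the real parts must be attained at a only. *)
Definition dominant_eigenvalue (R : realType) (n : nat) (M : 'M[R]_n) (a : R)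
    : Prop :=
  let MC : 'M[R[i]]_n := map_mx (real_complex R) M in
  eigenvalue MC a%:C%C /\
  (forall z : R[i], eigenvalue MC z -> z != a%:C%C -> complex.Re z < a).

Definition weight_matrix (R : realType) (n : nat) (W : 'M[R]_n) : Prop :=
  [/\ W^T = W, forall i j, 0 <= W i j & forall i, W i i = 0].

Definition graph_laplacian (R : realType) (n : nat) (W : 'M[R]_n) : 'M[R]_n :=
  \matrix_(i, j) (if i == j then - \sum_(k < n | k != i) W i k else W i j).

(* Irreducibility of [graph_laplacian W]. *)
Definition graph_irreducible (R : realType) (n : nat) (W : 'M[R]_n) : Prop :=
  forall i j : 'I_n, connect [rel k l | 0 < W k l] i j.

Definition Phi (R : realType) (n : nat) (gamma : R) (p : 'I_n -> R)
    (b0 : 'cV[R]_n) : R :=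
  \sum_(i < n) p i `^ (1 / gamma) * b0 i 0 `^ ((gamma - 1) / gamma).

Definition alpha (R : realType) (n : nat) (rho gamma : R) (p : 'I_n -> R)
    (lambda0 : R) (b0 : 'cV[R]_n) : R :=
  gamma * Phi gamma p b0 / (rho - lambda0 * (1 - gamma)).

Definition growth_rate (R : realType) (rho gamma lambda0 : R) : R :=
  (lambda0 - rho) / gamma.

Definition c_hat (R : realType) (n : nat) (gamma : R) (p : 'I_n -> R)
    (b0 : 'cV[R]_n) : 'cV[R]_n :=
  \col_i (p i / b0 i 0) `^ (1 / gamma).

Definition feedback_mx (R : realType) (n : nat) (rho gamma : R)
    (p : 'I_n -> R) (lambda0 : R) (b0 : 'cV[R]_n) : 'M[R]_n :=
  \matrix_(i, j) (1 / alpha rho gamma p lambda0 b0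
                  * (p i / b0 i 0) `^ (1 / gamma) * b0 j 0).

Definition y_vec (R : realType) (n : nat) (rho gamma : R)
    (p : 'I_n.+1 -> R) (lambda : 'I_n.+1 -> R)
    (b : 'I_n.+1 -> 'cV[R]_n.+1) : 'cV[R]_n.+1 :=
  let g := growth_rate rho gamma (lambda ord0) in
  alpha rho gamma p (lambda ord0) (b ord0) *: b ord0
  + \sum_(m < n.+1 | m != ord0)
      (dotv (c_hat gamma p (b ord0)) (b m) / (lambda m - g)) *: b m.

(* Main.v *)
(* F has rank one: F x = <b0, x> c_hat / alpha. Hence F kills b^1, ..., b^(n-1),
   and F y = c_hat since <b0, y> = alpha. Expanding c_hat in the basis b^m, whose
   b0-coefficient is Phi, turns B y = g y into the scalar identities
   alpha lambda_0 - Phi = alpha g and lambda_m - (lambda_m - g) = g. The vectors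
   y, b^1, ..., b^(n-1) span because alpha != 0, so B is diagonalizable and
   char_poly B = (X - g) prod_(m >= 1) (X - lambda_m), where g > lambda_m. *)
Require Import Defs.
From mathcomp Require Import all_boot all_order all_algebra.
From mathcomp Require Import complex.
From mathcomp Require Import all_classical all_reals all_analysis.
From mathcomp Require Import ring.

Set Implicit Arguments.
Unset Strict Implicit.
Unset Printing Implicit Defensive.

Import Order.TTheory GRing.Theory Num.Theory.

Local Open Scope ring_scope.

(** The matrix [Q] with columns [X] is invertible and satisfies [M *m Q = Q *m D] with [D] diagonal,
    so [M] and [D] share their characteristic polynomial. *)
Lemma char_poly_eigenbasis (F : fieldType) (n : nat) (M : 'M[F]_n)
    (X : seq 'cV[F]_n) (d : 'I_n -> F) :
  basis_of fullv X -> (forall i : 'I_n, M *m X`_i = d i *: X`_i) ->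
  char_poly M = \prod_(i < n) ('X - (d i)%:P).
Proof.
move=> bX MX.
have sX : size X == n.
  rewrite -(size_basis (X := in_tuple X) bX) dimvf dim_matrix; exact/eqP/muln1.
pose T := Tuple sX.
pose Q : 'M[F]_n := \matrix_(i, j) (X`_j) i 0.
pose D : 'M[F]_n := diag_mx (\row_i d i).
have colQ j : col j Q = X`_j by apply/matrixP => i k; rewrite !mxE ord1.
have MQ : M *m Q = Q *m D.
  apply/matrixP => i j; have := congr1 (fun u : 'cV_n => u i 0) (MX j).
  rewrite mul_mx_diag !mxE mulrC => <-.
  by apply: eq_bigr => k _; rewrite !mxE.
(* The coordinates of the unit vectors in the basis [X] form a right inverse of [Q]. *)
have /mulmx1_unit[uQ _] :
    Q *m (\matrix_(i, j) coord T i (delta_mx j 0)) = 1%:M.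
  apply/matrixP => i j.
  have : (delta_mx j 0 : 'cV[F]_n) \in <<T>>%VS by rewrite (span_basis bX) memvf.
  move=> /coord_span /(congr1 (fun u : 'cV_n => u i 0)).
  rewrite !mxE eqxx andbT => ->; rewrite summxE.
  by apply: eq_bigr => k _; rewrite !mxE mulrC.
have cQ : char_poly_mx M *m map_mx polyC Q = map_mx polyC Q *m char_poly_mx D.
  by rewrite mulmxBl mulmxBr -!map_mxM MQ scalar_mxC.
(* This determinant is a nonzero constant polynomial, hence cancellable. *)
have dQ : \det (map_mx polyC Q) != 0.
  by rewrite det_map_mx polyC_eq0 -unitfE -unitmxE.
have cMD : char_poly M = char_poly D.
  by apply: (mulIf dQ); rewrite -det_mulmx cQ det_mulmx mulrC.
rewrite cMD char_poly_trig ?diag_mx_is_trig //.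
by apply: eq_bigr => i _; rewrite !mxE eqxx mulr1n.
Qed.

(** The characteristic polynomial already splits over the reals, so passing to [R[i]] creates no
    further roots. *)
Lemma eigenvalue_complexE (R : realType) (n : nat) (M : 'M[R]_n)
    (d : 'I_n -> R) (z : R[i]) :
  char_poly M = \prod_(i < n) ('X - (d i)%:P) ->
  eigenvalue (map_mx (real_complex R) M) z = [exists i, z == (d i)%:C%C].
Proof.
move=> cM; rewrite eigenvalue_root_char -map_char_poly cM rmorph_prod /=.
rewrite /root horner_prod prodf_seq_eq0.
under eq_has => i do rewrite map_polyXsubC hornerXsubC subr_eq0.
apply/hasP/existsP => [[i _ ?]|[i ?]]; exists i => //.
by rewrite mem_index_enum.
Qed.

Lemma simple_dominant_char_poly (R : realType) (n : nat) (M : 'M[R]_n)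
    (d : 'I_n -> R) (k : 'I_n) :
  char_poly M = \prod_(i < n) ('X - (d i)%:P) ->
  (forall i, i != k -> d i < d k) ->
  dominant_eigenvalue M (d k) /\ simple_eigenvalue M (d k).
Proof.
move=> cM dk; split.
  split; first by rewrite (eigenvalue_complexE _ cM); apply/existsP; exists k.
  move=> z; rewrite (eigenvalue_complexE _ cM) => /existsP[i /eqP->] zk /=.
  by apply: dk; apply: contra_neq zk => ->.
(* The factors other than ['X - (d k)%:P] do not vanish at [d k], so they add nothing to the
   multiplicity. *)
rewrite /simple_eigenvalue cM (bigD1 k) //= mupMl.
  by have := mup_XsubCX 1 (d k) (d k); rewrite expr1 eqxx.
rewrite /root horner_prod prodf_seq_neq0; apply/allP => i _.
by apply/implyP => /dk /lt_eqF; rewrite hornerXsubC subr_eq0 eq_sym => ->.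
Qed.

Lemma dotv_suml (R : realType) (n : nat) (I : finType) (P : pred I)
    (k : I -> R) (v : I -> 'cV[R]_n) (u : 'cV[R]_n) :
  dotv (\sum_(i | P i) k i *: v i) u = \sum_(i | P i) k i * dotv (v i) u.
Proof.
rewrite /dotv.
under eq_bigr do rewrite summxE big_distrl /=.
rewrite exchange_big; apply: eq_bigr => i _; rewrite big_distrr /=.
by apply: eq_bigr => j _; rewrite !mxE mulrA.
Qed.

(** The matrix [P] with columns [b j] is square, so [P^T *m P = 1%:M] gives [P *m P^T = 1%:M];
    applied to [x], this is the expansion. *)
Lemma orthonormal_expansion (R : realType) (n : nat) (b : 'I_n -> 'cV[R]_n)
    (x : 'cV[R]_n) :
  orthonormal_family b -> x = \sum_i dotv x (b i) *: b i.
Proof.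
move=> hb; pose P : 'M[R]_n := \matrix_(i, j) b j i 0.
have /mulmx1C PPt : P^T *m P = 1%:M.
  apply/matrixP => i j; rewrite !mxE -hb.
  by apply: eq_bigr => k _; rewrite !mxE.
rewrite -[LHS]mul1mx -PPt -mulmxA; apply/matrixP => i j.
rewrite summxE [LHS]mxE; apply: eq_bigr => k _; rewrite !mxE mulrC ord1.
by congr (_ * _); apply: eq_bigr => l _; rewrite !mxE mulrC.
Qed.

Lemma dotv_c_hat (R : realType) (n : nat) (gamma : R) (p : 'I_n -> R)
    (v : 'cV[R]_n) :
  gamma != 0 -> (forall i, 0 < p i) -> (forall i, 0 < v i 0) ->
  dotv (c_hat gamma p v) v = Phi gamma p v.
Proof.
move=> g0 p0 v0; apply: eq_bigr => i _; have vi := v0 i.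
rewrite mxE powRM ?invr_ge0 ?ltW // -mulrA; congr (_ * _).
(* Splitting the exponent separates one plain factor [v i 0] from the power [- (1 / gamma)] that
   occurs in [c_hat]. *)
have -> : (gamma - 1) / gamma = - (1 / gamma) + 1.
  by rewrite mulrBl divff // addrC.
rewrite powRD ?(gt_eqF vi) ?implybT // powRr1 ?ltW //.
by rewrite -powR_inv1 ?ltW // -powRrM mulN1r.
Qed.

Lemma mulmx_feedback (R : realType) (n : nat) (rho gamma : R)
    (p : 'I_n -> R) (lambda0 : R) (b0 x : 'cV[R]_n) :
  feedback_mx rho gamma p lambda0 b0 *m x =
  ((alpha rho gamma p lambda0 b0)^-1 * dotv b0 x) *: c_hat gamma p b0.
Proof.
apply/matrixP => i j; rewrite !mxE ord1 /dotv mulrAC mulr_sumr.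
by apply: eq_bigr => k _; rewrite !mxE div1r !mulrA.
Qed.

Lemma growth_rate_ltE (R : realType) (rho gamma lambda0 : R) :
  0 < gamma ->
  (growth_rate rho gamma lambda0 < lambda0) = (lambda0 * (1 - gamma) < rho).
Proof.
by move=> g0; rewrite ltr_pdivrMr // ltrBlDr -ltrBlDl mulrBr mulr1.
Qed.

(** Writing g for the growth rate, [lambda0 - g = (rho - lambda0 * (1 - gamma)) / gamma], so [alpha]
    is [Phi / (lambda0 - g)]. *)
Lemma alpha_growth_rate (R : realType) (n : nat) (rho gamma : R)
    (p : 'I_n -> R) (lambda0 : R) (b0 : 'cV[R]_n) :
  gamma != 0 -> rho - lambda0 * (1 - gamma) != 0 ->
  alpha rho gamma p lambda0 b0 * growth_rate rho gamma lambda0 =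
  alpha rho gamma p lambda0 b0 * lambda0 - Phi gamma p b0.
Proof.
by move=> g0 h0; rewrite /alpha /growth_rate; field; rewrite h0.
Qed.

Lemma Phi_gt0 (R : realType) (n : nat) (gamma : R) (p : 'I_n.+1 -> R)
    (b0 : 'cV[R]_n.+1) :
  (forall i, 0 < p i) -> (forall i, 0 < b0 i 0) -> 0 < Phi gamma p b0.
Proof.
move=> p0 v0; rewrite /Phi big_ord_recl ltr_pwDl ?mulr_gt0 ?powR_gt0 //.
by apply: sumr_ge0 => i _; rewrite mulr_ge0 ?powR_ge0.
Qed.

Theorem proposition5p11 (R : realType) (n : nat) (rho gamma : R)
    (p : 'I_n.+2 -> R) (a : 'rV[R]_n.+2) (W : 'M[R]_n.+2)
    (lambda : 'I_n.+2 -> R) (b : 'I_n.+2 -> 'cV[R]_n.+2)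
    (hrho : 0 < rho) (hgamma : 0 < gamma) (hgamma1 : gamma != 1)
    (hp : forall i, 0 < p i) (ha : forall i, 0 < a 0 i)
    (hW : weight_matrix W)
    (hlambda : forall i j : 'I_n.+2, (i <= j)%N -> lambda j <= lambda i)
    (hb : orthonormal_family b)
    (hbE : forall m, is_eigenvector (graph_laplacian W + diag_mx a)
                                    (lambda m) (b m))
    (hb0 : forall i, 0 < b ord0 i 0)
    (hirr : graph_irreducible W) :
  let lambda0 := lambda ord0 in
  let lambda1 := lambda (lift ord0 ord0) in
  let g := growth_rate rho gamma lambda0 in
  let B := graph_laplacian W + diag_mx a
           - feedback_mx rho gamma p lambda0 (b ord0) in
  let y := y_vec rho gamma p lambda b in
  (rho > lambda0 * (1 - gamma) /\ g > lambda1 <-> lambda0 > g /\ g > lambda1)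
  /\ (rho > lambda0 * (1 - gamma) -> g > lambda1 ->
      [/\ basis_of fullv (y :: [seq b (lift ord0 m) | m : 'I_n.+1]),
          is_eigenvector B g y,
          forall m : 'I_n.+1,
            is_eigenvector B (lambda (lift ord0 m)) (b (lift ord0 m)),
          dominant_eigenvalue B g
        & simple_eigenvalue B g]).
Proof.
move=> lambda0 lambda1 g B y; have gN0 := lt0r_neq0 hgamma.
split; first by rewrite growth_rate_ltE.
move=> rho_gt g_gt; set b0 := b ord0; set A := alpha rho gamma p lambda0 b0.
have d_gt0 : 0 < rho - lambda0 * (1 - gamma) by rewrite subr_gt0.
have A_gt0 : 0 < A by rewrite divr_gt0 ?mulr_gt0 ?Phi_gt0.
(* The eigenvalues are sorted, so every one after the first is at most [lambda1]. *)
have lt_g m : m != ord0 -> lambda m < g.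
  case: (unliftP ord0 m) => [k ->|->]; last by rewrite eqxx.
  by move=> _; apply: le_lt_trans g_gt; apply: hlambda.
have LN0 m : m != ord0 -> lambda m - g != 0.
  by move=> /lt_g; rewrite -subr_lt0 => /ltr0_neq0.
pose s m := dotv (c_hat gamma p b0) (b m) / (lambda m - g).
have yE : y = A *: b0 + \sum_(m | m != ord0) s m *: b m by [].
have dot_y : dotv b0 y = A.
  rewrite /dotv; under eq_bigr do rewrite mulrC.
  rewrite -/(dotv y b0).
  (* Writing [y] as one sum over all indices lets orthonormality pick out the coefficient [A] of
     [b0]. *)
  have -> : y = \sum_m (if m == ord0 then A else s m) *: b m.
    rewrite yE [RHS](bigD1 ord0) //=; congr (_ + _).
    by apply: eq_bigr => m /negbTE->.
  rewrite dotv_suml (bigD1 ord0) //= hb eqxx mulr1 big1 ?addr0 // => m m0.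
  by rewrite hb (negbTE m0) mulr0.
have y_neq0 : y != 0.
  apply: contraTneq A_gt0 => y0; rewrite -dot_y y0 /dotv big1 ?ltxx // => i _.
  by rewrite mxE mulr0.
have By : B *m y = g *: y.
  rewrite /B mulmxBl mulmx_feedback dot_y mulVf ?gt_eqF // scale1r.
  rewrite [c_hat _ _ _](orthonormal_expansion _ hb) (bigD1 ord0) //=.
  rewrite dotv_c_hat // yE mulmxDr scalerDr -!scalemxAr mulmx_sumr scaler_sumr.
  rewrite (hbE ord0).2 opprD addrACA !scalerA -scalerBl.
  (* Both sides are now expanded in the [b m]: the [b0] terms agree by the choice of [alpha], the
     others by the choice of [s]. *)
  rewrite [g * A]mulrC alpha_growth_rate ?gt_eqF //; congr (_ + _).
  rewrite -sumrB; apply: eq_bigr => m m0.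
  rewrite -scalemxAr (hbE m).2 !scalerA -scalerBl; congr (_ *: _).
  by rewrite /s; field; apply: LN0.
have Bb (m : 'I_n.+1) :
    B *m b (lift ord0 m) = lambda (lift ord0 m) *: b (lift ord0 m).
  by rewrite /B mulmxBl (hbE _).2 mulmx_feedback hb mulr0 scale0r subr0.
set X := y :: _.
have memb m : b m \in <<X>>%VS.
  have memb' (k : 'I_n.+1) : b (lift ord0 k) \in <<X>>%VS.
    by apply: memv_span; rewrite inE fintype.image_f ?orbT.
  case: (unliftP ord0 m) => [k ->|->] //.
  (* As [A] is nonzero, the definition of [y] can be solved for [b0]. *)
  have -> : b ord0 = A^-1 *: (y - \sum_(m | m != ord0) s m *: b m).
    by rewrite yE addrK scalerA mulVf ?gt_eqF // scale1r.
  apply/memvZ/memvB; first by apply: memv_span; rewrite inE eqxx.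
  apply: memv_suml => i; case: (unliftP ord0 i) => [k -> _|->].
    exact/memvZ.
  by rewrite eqxx.
have bX : basis_of fullv X.
  (* A spanning family with no more vectors than the dimension is a basis, so linear independence
     needs no separate argument. *)
  rewrite basisEdim dimvf dim_matrix /= size_map -cardE card_ord.
  have -> : (n.+2 * 1)%R = n.+2 by exact: muln1.
  rewrite leqnn andbT.
  apply/subvP => x _; rewrite (orthonormal_expansion x hb).
  by apply: memv_suml => i _; apply/memvZ.
(* The eigenvalues in the order of [X]: [g] takes the place of [lambda ord0], as [y] takes that of
   [b ord0]. *)
pose d (i : 'I_n.+2) := if i == ord0 then g else lambda i.
have cB : char_poly B = \prod_(i < n.+2) ('X - (d i)%:P).
  apply: (char_poly_eigenbasis bX) => i; rewrite /d.
  case: (unliftP ord0 i) => [k ->|->] //=.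
  rewrite add0n (nth_map ord0) ?size_enum_ord ?nth_ord_enum; last exact: ltn_ord.
  exact: Bb.
have [dom simp] : dominant_eigenvalue B (d ord0) /\ simple_eigenvalue B (d ord0).
  apply: simple_dominant_char_poly => // i i0.
  by rewrite /d (negbTE i0); apply: lt_g.
by split=> // m; split=> //; have [] := hbE (lift ord0 m).
Qed.
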